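(* Let $\mathcal G$ be the group of complex $r$-th roots of unity for some integer $r\ge 2$, and let $\vec T=(\vec T_1,\vec T_2)$ be a $2k$-tuple of edges of $\vec G$. If either (i) $\vec T$ satisfies Condition 1 or Condition 2 at every vertex $b$ of $H$, or (ii) $r=2$ and $\vec T$ satisfies Condition 1, 2 or 3 at every vertex $b$ of $H$, then $\mathcal Q(\vec T_1)\overline{\mathcal Q(\vec T_2)}=1$. Otherwise $E\big(\mathcal Q(\vec T_1)\overline{\mathcal Q(\vec T_2)}\big)=0$.
   Context: $H$ is a connected finite simple graph with no leaves, vertices $1,\dots,t$, $k$ edges, oriented arbitrarily as $\vec H$ with directed edges $\overrightarrow{a_1a_2},\dots,\overrightarrow{a_{2k-1}a_{2k}}$. $\Gamma(b)=\{i:a_i=b\}$; a distinguished index $\iota(b)\in\Gamma(b)$ is fixed. $G$ is a finite simple graph; $\vec G$ replaces each edge $vw$ by $\overrightarrow{vw},\overrightarrow{wv}$. Hash functions $\mathcal X_i:V(G)\to\mathcal G$ ($1\le i\le 2k$): non-distinguished ones chosen independently and uniformly from a $4k$-wise independent family with uniform values; for $i=\iota(b)$, $\mathcal X_i(v)=\prod_{j\in\Gamma(b),j\ne i}\mathcal X_j(v)^{-1}$ ($=1$ if $\Gamma(b)=\{i\}$). Write $\vec T_1=(\overrightarrow{v_1v_2},\dots,\overrightarrow{v_{2k-1}v_{2k}})$, $\vec T_2=(\overrightarrow{w_1w_2},\dots,\overrightarrow{w_{2k-1}w_{2k}})$; $\mathcal Q(\vec T_1)=\prod_{j=1}^{2k}\mathcal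 X_j(v_j)$, $\mathcal Q(\vec T_2)=\prod_{j=1}^{2k}\mathcal X_j(w_j)$; the bar is complex conjugation. Conditions at $b$: Condition 1: the $v_i$, $i\in\Gamma(b)$, are all equal and the $w_i$, $i\in\Gamma(b)$, are all equal. Condition 2: $v_i=w_i$ for all $i\in\Gamma(b)$. Condition 3: there are vertices $x,y$ of $G$ such that for every $i\in\Gamma(b)$, either ($v_i=x$, $w_i=y$) or ($v_i=y$, $w_i=x$). *)

(* Defs.v *)
From HB Require Import structures.
From mathcomp Require Import all_boot all_order all_algebra.
From mathcomp Require Import reals complex.

Set Implicit Arguments.
Unset Strict Implicit.
Unset Printing Implicit Defensive.

Import Order.TTheory GRing.Theory Num.Theory.

Local Open Scope ring_scope.

Record sgraph (V : finType) := SGraph {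
  adj :> rel V;
  adj_sym : symmetric adj;
  adj_irrefl : irreflexive adj
}.

Section Graphs.
Variables (V : finType) (G : sgraph V).

Definition edges : {set {set V}} := [set [set p.1; p.2] | p : V * V & G p.1 p.2].

Definition connected_graph : Prop :=
  (0 < #|V|)%N /\ forall x y : V, connect G x y.

Definition no_leaves : Prop := forall x : V, #|[set y | G x y]| != 1%N.

End Graphs.

(* Half-edges are indexed from 0: the j-th arc (j < k) goes from the entry of
   index 2j to the entry of index 2j + 1 of a sequence of length 2k. *)
Lemma arc_tail_subproof (k : nat) (j : 'I_k) : (j.*2 < k.*2)%N.
Proof. by rewrite ltn_double. Qed.

Lemma arc_head_subproof (k : nat) (j : 'I_k) : (j.*2.+1 < k.*2)%N.
Proof. by rewrite ltn_Sdouble. Qed.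

Definition arc_tail (k : nat) (j : 'I_k) : 'I_k.*2 := Ordinal (arc_tail_subproof j).
Definition arc_head (k : nat) (j : 'I_k) : 'I_k.*2 := Ordinal (arc_head_subproof j).

(* The k arcs given by a are the edges of H, each listed exactly once, in one
   of its two directions. *)
Definition orientation (V : finType) (H : sgraph V) (k : nat)
    (a : 'I_k.*2 -> V) : Prop :=
  let arc_edge (j : 'I_k) := [set a (arc_tail j); a (arc_head j)] in
  injective arc_edge /\ [set arc_edge j | j : 'I_k] = edges H.

(* A k-tuple of edges of the digraph obtained from G by replacing every edge
   with its two orientations, given by the 2k endpoints. *)
Definition arc_tuple (V : finType) (G : sgraph V) (k : nat)
    (v : 'I_k.*2 -> V) : Prop :=
  forall j : 'I_k, G (v (arc_tail j)) (v (arc_head j)).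

Definition Gamma (B : finType) (n : nat) (a : 'I_n -> B) (b : B) : {set 'I_n} :=
  [set i | a i == b].

Section Conditions.
Variables (B V : finType) (n : nat) (a : 'I_n -> B) (v w : 'I_n -> V).

Definition condition1 (b : B) : Prop :=
  {in Gamma a b &, forall i j, v i = v j} /\
  {in Gamma a b &, forall i j, w i = w j}.

Definition condition2 (b : B) : Prop := {in Gamma a b, forall i, v i = w i}.

Definition condition3 (b : B) : Prop :=
  exists x y : V, {in Gamma a b, forall i,
    (v i = x /\ w i = y) \/ (v i = y /\ w i = x)}.

End Conditions.

Section HashFamilies.
Variables (R : realType) (r : nat) (V K : finType) (h : K -> V -> R[i]).

Definition prob (A : {pred K}) : R := #|A|%:R / #|K|%:R.

Definition root_valued : Prop := forall s x, r.-unity_root (h s x).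

Definition uniform_values : Prop := forall (x : V) (z : R[i]),
  r.-unity_root z -> prob [pred s | h s x == z] = r%:R^-1.

(* Independence of the values at any at most m distinct points; with exactly m
   points this would be vacuous when #|V| < m. *)
Definition wise_independent (m : nat) : Prop :=
  forall (S : {set V}) (g : V -> R[i]),
    (#|S| <= m)%N -> (forall x, r.-unity_root (g x)) ->
    prob [pred s | [forall x in S, h s x == g x]] =
      \prod_(x in S) prob [pred s | h s x == g x].

(* The members of the family are indexed by K, so repetitions are allowed and
   a uniform choice is a uniform s : K. *)
Definition hash_family (m : nat) : Prop :=
  [/\ (0 < #|K|)%N, root_valued, uniform_values & wise_independent m].

End HashFamilies.

Section RandomHash.
Variables (R : realType) (B V K : finType) (h : K -> V -> R[i]).
Variables (n : nat) (a : 'I_n -> B) (iota : B -> 'I_n).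

(* An outcome picks independently a member of the family for every index; its
   coordinates at the distinguished indices are never used. *)
Definition hash (omega : {ffun 'I_n -> K}) (i : 'I_n) (x : V) : R[i] :=
  if i == iota (a i)
  then \prod_(j in Gamma a (a i) | j != i) (h (omega j) x)^-1
  else h (omega i) x.

Definition Q (v : 'I_n -> V) (omega : {ffun 'I_n -> K}) : R[i] :=
  \prod_(j < n) hash omega j (v j).

End RandomHash.

Definition expectation (R : realType) (Omega : finType) (f : Omega -> R[i]) :
  R[i] := (\sum_omega f omega) / #|Omega|%:R.

(* Main.v *)
(* Values of the hash functions have modulus 1, so conjugation is inversion.
   Substituting the definition of the distinguished hash functions turns
   Q(T1) Q(T2)^* into a product over all indices j, with i = iota (a j), of
   X_j(v_j) X_j(w_i) / (X_j(v_i) X_j(w_j)), where the factors with j = i are 1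
   and the others are independent.  A factor in which the exponents of the at
   most four points cancel modulo r is 1; otherwise its mean contains, by
   4-wise independence, a factor sum_(z^r = 1) z^c with r not dividing c, which
   vanishes.  Cancellation for all indices at b amounts to the conditions. *)

Require Import Defs.
From HB Require Import structures.
From mathcomp Require Import all_boot all_order all_algebra.
From mathcomp Require Import cyclic separable cyclotomic.
From mathcomp Require Import reals complex.

Set Implicit Arguments.
Unset Strict Implicit.
Unset Printing Implicit Defensive.

Import Order.TTheory GRing.Theory Num.Theory.

Local Open Scope ring_scope.

(** * Roots of unity and their power sums *)

Lemma primitive_root_exists (C : numClosedFieldType) (n : nat) :
  (0 < n)%N -> exists z : C, n.-primitive_root z.
Proof.
move=> n_gt0; pose p : {poly C} := 'X^n - 1.
have [s Dp] := closed_field_poly_normal p.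
rewrite (monicP _) ?monicXnsubC // scale1r in Dp.
have sn1: all n.-unity_root s by apply/allP=> z; rewrite -root_prod_XsubC -Dp.
have sz_s: (n < (size s).+1)%N.
  by rewrite -(size_prod_XsubC s id) -Dp size_XnsubC.
(* In characteristic 0 the polynomial ['X^n - 1] is separable, so [s] lists [n] distinct roots, and
   these must include a primitive one. *)
have [|z] := hasP (has_prim_root n_gt0 sn1 _ sz_s); last by exists z.
by rewrite -separable_prod_XsubC -Dp separable_Xn_sub_1 // pnatr_eq0 -lt0n.
Qed.

Lemma conj_unity_root (C : numClosedFieldType) (n : nat) (z : C) :
  (0 < n)%N -> n.-unity_root z -> z^* = z^-1.
Proof.
move=> n_gt0; rewrite unity_rootE => /eqP zn1.
have /eqP nz1: `|z| == 1 by rewrite -(pexpr_eq1 n_gt0) // -normrX zn1 normr1.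
by rewrite invC_norm nz1 expr1n invr1 mul1r.
Qed.

(** This is a geometric sum of ratio [z ^+ c]: multiplied by [z ^+ c - 1], which is nonzero, it
    telescopes to 0. *)
Lemma sum_expr_primitive_root (F : fieldType) (n : nat) (z : F) (c : nat) :
  n.-primitive_root z -> ~~ (n %| c)%N -> \sum_(i < n) (z ^+ i) ^+ c = 0.
Proof.
move=> prim_z ndvd.
have zc_neq1: z ^+ c - 1 != 0 by rewrite subr_eq0 -(prim_order_dvd prim_z).
apply: (mulfI zc_neq1); rewrite mulr0.
under eq_bigr => i _ do rewrite exprAC.
by rewrite -subrX1 exprAC (prim_expr_order prim_z) expr1n subrr.
Qed.

(* Characterises when [p + q - p' - q' = 0] in the free Z/r-module on V, i.e.
   when [h p * h q / (h p' * h q') = 1] for every r-th-root-valued h. *)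
Definition trivial_quad (V : eqType) (r : nat) (p q p' q' : V) : bool :=
  [|| (p == p') && (q == q'), (p == q') && (q == p')
    | [&& r == 2, p == q & p' == q']]%N.

(** Testing at the four points suffices. For [r > 2] the counts are below [r], so the congruences
    are equalities and the two pairs agree as multisets; for [r = 2] only parities are known, which
    also allows each pair to cancel by itself. *)
Lemma trivial_quad_count (V : eqType) (r : nat) (p q p' q' : V) :
  (1 < r)%N ->
  (forall x, (x == p) + (x == q) = (x == p') + (x == q') %[mod r])%N ->
  trivial_quad r p q p' q'.
Proof.
move=> r_gt1 eq_count; rewrite /trivial_quad.
have [r2 | r_neq2] := eqVneq r 2%N; last first.
  have r_gt2: (2 < r)%N by rewrite ltn_neqAle eq_sym r_neq2.
  have le2 (b c : bool) : (b + c < r)%N.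
    by apply: leq_trans r_gt2; case: b; case: c.
  move: (eq_count p) (eq_count q) (eq_count p') (eq_count q').
  rewrite !modn_small // !eqxx (eq_sym q p) (eq_sym p' p) (eq_sym p' q).
  rewrite (eq_sym q' p) (eq_sym q' q) (eq_sym q' p').
  by do 6!case: (_ == _).
move: (eq_count p) (eq_count q) (eq_count p') (eq_count q'); rewrite r2.
have [<-|] := eqVneq p q; have [<-|] := eqVneq p p';
  have [<-|] := eqVneq p q'; rewrite ?eqxx // ?(eq_sym _ p).
all: do ?move/negPf->; by do ?case: (_ == _).
Qed.

(** * Moments of a random member of the family *)

Section HashMoments.
Variables (R : realType) (r : nat) (V K : finType) (h : K -> V -> R[i]).
Variables (m : nat) (r_gt1 : (1 < r)%N) (Hh : hash_family r h m).

Let r_gt0 : (0 < r)%N. Proof. exact: ltnW. Qed.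

Lemma hash_unity_root s x : r.-unity_root (h s x).
Proof. by case: Hh => _ + _ _; apply. Qed.

Lemma hash_exprr s x : h s x ^+ r = 1.
Proof. by have := hash_unity_root s x; rewrite unity_rootE => /eqP. Qed.

Lemma hash_neq0 s x : h s x != 0.
Proof.
apply/eqP => h0; have := hash_exprr s x.
by rewrite h0 expr0n -leqn0 leqNgt r_gt0 => /eqP; rewrite eq_sym oner_eq0.
Qed.

Lemma hash_invr s x : (h s x)^-1 = h s x ^+ r.-1.
Proof.
apply: (mulfI (hash_neq0 s x)).
by rewrite mulfV ?hash_neq0 // -exprS prednK // hash_exprr.
Qed.

(** Each point of [S] contributes a probability [1/r]. With denominators cleared the identity lives
    in [nat], so it passes from [R], where [prob] takes its values, to [R[i]]. *)
Lemma card_hash_fiber (S : {set V}) (g : V -> R[i]) :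
    (#|S| <= m)%N -> (forall x, r.-unity_root (g x)) ->
  (#|[pred s | [forall x in S, h s x == g x]]| * r ^ #|S| = #|K|)%N.
Proof.
move=> le_m g_root; case: Hh => K_gt0 _ unif indep.
have K_neq0: #|K|%:R != 0 :> R by rewrite pnatr_eq0 -lt0n.
have r_neq0: r%:R != 0 :> R by rewrite pnatr_eq0 -lt0n.
have := indep S g le_m g_root.
rewrite (eq_bigr (fun=> r%:R^-1)) => [|x _]; last exact: unif.
rewrite prodr_const /prob => /(congr1 (fun y : R => y * #|K|%:R * r%:R ^+ #|S|)).
rewrite divfK // exprVn mulrAC mulVf ?expf_neq0 // mul1r -natrX -natrM => /eqP.
by rewrite eqr_nat => /eqP.
Qed.

(** On at most [m] points the values are independent and uniform over the powers of [z], so the mean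
    factors. *)
Lemma expectation_hash_prod (z : R[i]) (S : {set V}) (F : V -> R[i] -> R[i]) :
    r.-primitive_root z -> (#|S| <= m)%N ->
  expectation (fun s => \prod_(x in S) F x (h s x)) =
    \prod_(x in S) ((\sum_(i < r) F x (z ^+ i)) / r%:R).
Proof.
move=> prim_z le_m; pose i0 : 'I_r := Ordinal r_gt0.
have K_neq0: #|K|%:R != 0 :> R[i] by case: Hh => ? _ _ _; rewrite pnatr_eq0 -lt0n.
have r_neq0: r%:R != 0 :> R[i] by rewrite pnatr_eq0 -lt0n.
(* Sum over all patterns [f] of exponents on [S]; the indicator selects the pattern realised by [s].
   Outside [S] the patterns take the default value [i0]. *)
have expand s : \prod_(x in S) F x (h s x) =
    \sum_(f in pffun_on i0 [in S] predT) [forall x in S, h s x == z ^+ f x]%:R *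
      \prod_(x in S) F x (z ^+ f x).
  have ind x : F x (h s x) =
      \sum_(i < r) (h s x == z ^+ i)%:R * F x (z ^+ i).
    have [i Di] := prim_rootP prim_z (hash_exprr s x).
    rewrite (bigD1 i) //= Di eqxx mul1r big1 ?addr0 // => j j_neq_i.
    rewrite (eq_prim_root_expr prim_z) !modn_small //.
    by rewrite eq_sym -val_eqE /= in j_neq_i *; rewrite (negPf j_neq_i) mul0r.
  under eq_bigr => x _ do rewrite ind.
  rewrite (big_distr_big i0); apply: eq_bigr => f _; rewrite big_split /=.
  congr (_ * _).
  have [/forall_inP all_eq | ] := boolP [forall x in S, h s x == z ^+ f x].
    by rewrite big1 // => x /all_eq ->.
  by case/forall_inPn => x xS neq; rewrite (bigD1 x) //= (negPf neq) mul0r.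
rewrite /expectation (eq_bigr _ (fun s _ => expand s)) exchange_big /=.
rewrite big_split /= prodr_const (big_distr_big i0) /= !mulr_suml.
apply: eq_bigr => f _; rewrite -mulr_suml mulrAC mulrC; congr (_ * _).
have g_root x : r.-unity_root (z ^+ f x).
  by rewrite unity_rootE exprAC (prim_expr_order prim_z) expr1n.
have := card_hash_fiber le_m g_root.
set A := [pred s | _] => card_A.
have -> : \sum_s [forall x in S, h s x == z ^+ f x]%:R = #|A|%:R :> R[i].
  rewrite -sum1_card natr_sum [RHS]big_mkcond /=; apply: eq_bigr => s _.
  by rewrite inE; case: ifP.
apply: (mulIf K_neq0); rewrite divfK // -card_A natrM natrX mulrC -mulrA.
by rewrite exprVn mulfV ?mulr1 // expf_neq0.
Qed.

Lemma expectation_quad (p q p' q' : V) :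
    (4 <= m)%N -> ~~ trivial_quad r p q p' q' ->
  expectation (fun s => h s p * h s q / (h s p' * h s q')) = 0.
Proof.
move=> m_ge4 nontriv; have [z prim_z] := primitive_root_exists R[i] r_gt0.
(* [c x] is the total exponent of [h s x], with [r.-1] standing for -1 modulo [r]. *)
pose c x := ((x == p) + (x == q) + r.-1 * ((x == p') + (x == q')))%N.
have [/forallP dvd | /forallPn [x ndvd]] := boolP [forall x, r %| c x]%N.
  case/negP: nontriv; apply: trivial_quad_count => // x; apply/eqP.
  rewrite -(eqn_modDr (r.-1 * ((x == p') + (x == q')))) -mulSn prednK //.
  by rewrite [X in _ == X]modnMr; apply: dvd.
pose S := [set p; q; p'; q'].
have card_S: (#|S| <= m)%N.
  apply: leq_trans m_ge4; rewrite /S -(card_ord 4).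
  have -> : [set p; q; p'; q'] = [set y in [:: p; q; p'; q']].
    by apply/setP => y; rewrite !inE -!orbA.
  by rewrite cardsE card_ord (leq_trans (card_size _)).
(* Writing each of the four factors as a product over [S] lets exponents add up when some of the
   points coincide. *)
have prod_pick s y (yS : y \in S) k :
    \prod_(x in S) h s x ^+ (k * (x == y)) = h s y ^+ k.
  rewrite (bigD1 y) //= eqxx muln1 big1 ?mulr1 // => u /andP[_ /negPf ->].
  by rewrite muln0.
have -> : expectation (fun s => h s p * h s q / (h s p' * h s q')) =
    expectation (fun s => \prod_(x in S) h s x ^+ c x).
  rewrite /expectation; congr (_ / _); apply: eq_bigr => s _.
  rewrite invfM !hash_invr -[h s p]expr1 -[h s q]expr1.
  rewrite -(prod_pick s p _ 1%N) ?inE ?eqxx // -(prod_pick s q _ 1%N) ?inE ?eqxx ?orbT //.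
  rewrite -(prod_pick s p') ?inE ?eqxx ?orbT // -(prod_pick s q') ?inE ?eqxx ?orbT //.
  rewrite -!big_split /=; apply: eq_bigr => y _.
  by rewrite -!exprD !mul1n /c mulnDr.
rewrite (expectation_hash_prod (fun x u => u ^+ c x) prim_z card_S).
(* Outside [S] the exponent [c x] is 0, which [r] divides. *)
have xS: x \in S.
  apply: contraR ndvd; rewrite !inE !negb_or /c -!andbA.
  by case/and4P => /negPf-> /negPf-> /negPf-> /negPf->; rewrite muln0 dvdn0.
by rewrite (bigD1 x) //= sum_expr_primitive_root // mul0r mul0r.
Qed.

Lemma trivial_quad_ratio (s : K) (p q p' q' : V) :
  trivial_quad r p q p' q' -> h s p * h s q / (h s p' * h s q') = 1.
Proof.
have neq0 := hash_neq0 s.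
case/or3P => [/andP[/eqP-> /eqP->] | /andP[/eqP-> /eqP->] |].
- by rewrite divff // mulf_neq0.
- by rewrite [h s q' * _]mulrC divff // mulf_neq0.
case/and3P => /eqP r2 /eqP-> /eqP->; have := hash_exprr s.
by rewrite r2 -!expr2 => e; rewrite !e divr1.
Qed.

Variables (B : finType) (n : nat) (a : 'I_n -> B) (iota : B -> 'I_n).
Hypothesis (Hiota : forall b : B, iota b \in Gamma a b).

Lemma hash_ratio (v w : 'I_n -> V) (omega : {ffun 'I_n -> K}) :
  Q h a iota v omega * (Q h a iota w omega)^* =
    \prod_j (h (omega j) (v j) * h (omega j) (w (iota (a j))) /
             (h (omega j) (v (iota (a j))) * h (omega j) (w j))).
Proof.
have neq0 j x : h (omega j) x != 0 by apply: hash_neq0.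
have conjh j x : (h (omega j) x)^* = (h (omega j) x)^-1.
  exact: conj_unity_root r_gt0 (hash_unity_root _ _).
have conj_hash j x : (hash h a iota omega j x)^* = (hash h a iota omega j x)^-1.
  rewrite /hash; case: ifP => // _; rewrite rmorph_prod -prodfV.
  by apply: eq_bigr => i _; rewrite fmorphV /= conjh.
rewrite /Q rmorph_prod -big_split /=.
(* The distinguished function at [b] involves only indices in [Gamma a b], so both sides can be
   compared vertex by vertex. *)
rewrite [LHS](partition_big a predT) //= [RHS](partition_big a predT) //=.
apply: eq_bigr => b _; have /[!inE]/eqP ab := Hiota b.
rewrite [LHS](bigD1 (iota b)) ?ab //= [RHS](bigD1 (iota b)) ?ab //=.
rewrite [X in _ = X * _]divff ?mulf_neq0 ?neq0 // mul1r.
rewrite conj_hash /hash ab eqxx -!prodfV.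
under [X in X * _ * _]eq_bigl => j do rewrite inE.
under [X in _ * X * _]eq_bigl => j do rewrite inE.
rewrite -!big_split /=; apply: eq_bigr => j /andP[/eqP aj j_neq].
rewrite aj (negPf j_neq) conjh invrK invfM.
by rewrite [LHS]mulrACA [RHS]mulrACA [_^-1 * _]mulrC.
Qed.

End HashMoments.

(** * Cancellation at a vertex and the three conditions *)

Section Conditions.
Variables (B V : finType) (n : nat) (a : 'I_n -> B) (iota : B -> 'I_n).
Hypothesis (Hiota : forall b : B, iota b \in Gamma a b).
Variables (r : nat) (v w : 'I_n -> V).

Let triv j := trivial_quad r (v j) (w (iota (a j))) (v (iota (a j))) (w j).

Lemma conditions_trivial (j : 'I_n) :
  condition1 a v w (a j) \/ condition2 a v w (a j) \/
    r = 2 /\ condition3 a v w (a j) -> triv j.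
Proof.
have j_in: j \in Gamma a (a j) by rewrite inE.
have i_in := Hiota (a j); rewrite /triv /trivial_quad.
case=> [[eq_v eq_w] | [eq_vw | [-> [x [y xy]]]]].
- by rewrite (eq_v _ _ j_in i_in) (eq_w _ _ j_in i_in) !eqxx.
- by rewrite (eq_vw _ j_in) (eq_vw _ i_in) !eqxx orbT.
by case: (xy _ j_in) (xy _ i_in) => [][-> ->] [][-> ->]; rewrite !eqxx ?orbT.
Qed.

(** The values at [i = iota b] decide which condition holds, uniformly in [j]. If [v i = w i], every
    form of triviality gives [v j = w j]. Otherwise the crossed form is excluded, leaving
    [v j = v i], [w j = w i] or, when [r = 2], the swap of these values. *)
Lemma trivial_conditions (b : B) : {in Gamma a b, forall j, triv j} ->
  condition1 a v w b \/ condition2 a v w b \/ r = 2 /\ condition3 a v w b.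
Proof.
move=> trivb; set i := iota b.
have {}trivb j : j \in Gamma a b -> trivial_quad r (v j) (w i) (v i) (w j).
  by move=> jb; have := trivb j jb; rewrite /triv; move: jb; rewrite inE => /eqP->.
have [vw_i | vw_i] := eqVneq (v i) (w i).
  right; left=> j /trivb; rewrite /trivial_quad vw_i (eq_sym (w i)).
  by case/or3P => [/andP[/eqP-> /eqP->] | /andP[/eqP->] | /and3P[_ /eqP-> /eqP->]].
have [r2 | r_neq2] := eqVneq r 2%N.
  right; right; split=> //; exists (v i), (w i) => j /trivb.
  rewrite /trivial_quad eq_sym [w i == v i]eq_sym (negPf vw_i) andbF /=.
  case/orP => [/andP[/eqP-> /eqP->] | /and3P[_ /eqP-> /eqP->]]; first by left.
  by right.
left; have eq_i j : j \in Gamma a b -> v j = v i /\ w j = w i.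
  move/trivb; rewrite /trivial_quad (negPf r_neq2) [w i == v i]eq_sym.
  by rewrite (negPf vw_i) andbF /= orbF => /andP[/eqP-> /eqP->].
by split=> j j' /eq_i[? ?] /eq_i[? ?]; congruence.
Qed.

End Conditions.

Theorem theorem3p2 (R : realType) (r : nat) (hr : (2 <= r)%N)
  (t k : nat) (H : sgraph 'I_t)
  (Hconn : connected_graph H) (Hleaf : no_leaves H)
  (a : 'I_k.*2 -> 'I_t) (Ha : orientation H a)
  (iota : 'I_t -> 'I_k.*2) (Hiota : forall b : 'I_t, iota b \in Gamma a b)
  (V : finType) (G : sgraph V)
  (K : finType) (h : K -> V -> R[i]) (Hh : hash_family r h (4 * k))
  (v w : 'I_k.*2 -> V) (Hv : arc_tuple G v) (Hw : arc_tuple G w) :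
  let case_i :=
    forall b : 'I_t, condition1 a v w b \/ condition2 a v w b in
  let case_ii :=
    r = 2%N /\
    forall b : 'I_t,
      [\/ condition1 a v w b, condition2 a v w b | condition3 a v w b] in
  (case_i \/ case_ii ->
    forall omega : {ffun 'I_k.*2 -> K},
      Q h a iota v omega * (Q h a iota w omega)^* = 1) /\
  (~ (case_i \/ case_ii) ->
    expectation (fun omega : {ffun 'I_k.*2 -> K} =>
      Q h a iota v omega * (Q h a iota w omega)^*) = 0).
Proof.
move=> case_i case_ii; split=> [cases omega | not_cases].
  rewrite (hash_ratio hr Hh Hiota) big1 // => j _.
  apply: (trivial_quad_ratio hr Hh); apply: (conditions_trivial Hiota).
  case: cases => [/(_ (a j)) | [r2 /(_ (a j))]]; first by tauto.
  by case; tauto.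
have [/forallP triv | /forallPn [j ntriv]] := boolP [forall j,
    trivial_quad r (v j) (w (iota (a j))) (v (iota (a j))) (w j)].
  case: not_cases.
  have conds b := @trivial_conditions _ _ _ a iota r v w b (fun j _ => triv j).
  have [r2 | r_neq2] := eqVneq r 2%N.
    right; split=> // b.
    by case: (conds b) => [|[|[]]]; [constructor 1|constructor 2|constructor 3].
  left=> b; case: (conds b) => [|[|[r2]]]; try tauto.
  by rewrite r2 in r_neq2.
(* The index [j] witnesses [k > 0], so [4 * k]-wise independence covers the four points. *)
have k_gt0: (0 < k)%N by rewrite -double_gt0; apply: leq_trans (ltn_ord j).
rewrite /expectation (eq_bigr _ (fun omega _ => hash_ratio hr Hh Hiota v w omega)).
(* The coordinates of [omega] are independent, so the sum over [omega] is a product of sums over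
   [K]; the one at [j] vanishes. *)
rewrite -(bigA_distr_bigA (fun j s => h s (v j) * h s (w (iota (a j))) /
  (h s (v (iota (a j))) * h s (w j)))) (bigD1 j) //=.
have := expectation_quad hr Hh (leq_pmulr 4 k_gt0) ntriv.
move/eqP; rewrite /expectation mulf_eq0 invr_eq0 pnatr_eq0.
case: Hh => /lt0n_neq0/negPf-> _ _ _; rewrite orbF => /eqP->.
by rewrite !mul0r.
Qed.
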